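(* The domain $\mathcal{SPL}$ of single-plateaued preferences is a maximal domain for own-peak-onliness, efficiency, the equal division guarantee, and not obvious manipulability (NOM). That is: $\mathcal{SP}\subseteq\mathcal{SPL}$; there exists a rule on $\mathcal{E}_{\mathcal{SPL}}$ satisfying these four properties; and for every domain $\overline{\mathcal{D}}$ with $\mathcal{SPL}\subsetneq\overline{\mathcal{D}}\subseteq\mathcal{U}$ there is no rule on $\mathcal{E}_{\overline{\mathcal{D}}}$ satisfying these four properties.
   Context: Let $N=\{1,\dots,n\}$ be a finite set of agents. $\mathcal{U}$ is the set of all continuous complete preorders $R_i$ on $\mathbb{R}_+\cup\{\infty\}$ ($P_i$ strict part, $I_i$ indifference). The peak is $p(R_i)=\{x:xR_iy\ \forall y\}$, $\underline{p}(R_i)=\inf p(R_i)$, $\overline{p}(R_i)=\sup p(R_i)$. $R_i$ is single-peaked if $p(R_i)$ is a singleton and for $x,x'\in\mathbb{R}_+$, $xP_ix'$ whenever $x'<x\le p(R_i)$ or $p(R_i)\le x<x'$ ($\mathcal{SP}$ = set of these). $R_i$ is single-plateaued if $p(R_i)=[\underline{p}(R_i),\overline{p}(R_i)]$ and for $x,x'\in\mathbb{R}_+$, $xP_ix'$ whenever $x'<x\le\underline{p}(R_i)$ or $\overline{p}(R_i)\le x<x'$ ($\mathcal{SPL}$ = set of these). For a domain $\mathcal{D}\subseteq\mathcal{U}$, an economy is $(R,\Omega)$ with $R\in\mathcal{D}^n$, $\Omega>0$, and $\mathcal{E}_{\mathcal{D}}$ is the set of these; a rule on $\mathcal{E}_{\mathcal{D}}$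 is a map $\varphi:\mathcal{E}_{\mathcal{D}}\to\mathbb{R}^n_+$ with $\sum_j\varphi_j(R,\Omega)=\Omega$. Properties (on $\mathcal{E}_{\mathcal{D}}$): Efficiency: no $x\in\mathbb{R}^n_+$ with $\sum_jx_j=\Omega$ has $x_iR_i\varphi_i(R,\Omega)$ for all $i$ and $x_iP_i\varphi_i(R,\Omega)$ for some $i$. Own-peak-onliness: for $R_i'\in\mathcal{D}$ with $p(R_i')=p(R_i)$, $\varphi_i(R,\Omega)=\varphi_i(R_i',R_{-i},\Omega)$. Equal division guarantee: if $\Omega/n\in p(R_i)$ then $\varphi_i(R,\Omega)I_i\Omega/n$. Option set $O^\varphi(R_i,\Omega)=\{\varphi_i(R_i,R_{-i},\Omega):R_{-i}\in\mathcal{D}^{n-1}\}$; $R_i'\in\mathcal{D}$ is a manipulation at $(R_i,\Omega)$ if $\varphi_i(R_i',R_{-i},\Omega)P_i\varphi_i(R_i,R_{-i},\Omega)$ for some $R_{-i}\in\mathcal{D}^{n-1}$, and an obvious manipulation if moreover each $x'\in O^\varphi(R_i',\Omega)$ satisfies $x'P_ix$ for some $x\in O^\varphi(R_i,\Omega)$; NOM means no obvious manipulation exists.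
   Formalization: The theorem assumes at least two agents (n ≥ 2); with n = 1 the only rule gives Ω to the single agent and satisfies all four properties on every domain, so the maximality claim fails there, and with n = 0 no rule exists. *)

(* Defs.v *)
(* preferences are relations on \bar R,
   supported on [0, +oo] (= R_+ \cup {oo}). *)
From HB Require Import structures.
From mathcomp Require Import all_boot all_order all_algebra.
From mathcomp Require Import all_classical all_reals all_analysis.
Set Implicit Arguments. Unset Strict Implicit. Unset Printing Implicit Defensive.
Import Order.TTheory GRing.Theory Num.Theory.
Local Open Scope classical_set_scope.
Local Open Scope ring_scope.

Definition pref (R : realType) := \bar R -> \bar R -> Prop.

Definition Xdom (R : realType) : set (\bar R) := [set x | (0 <= x)%E].

Definition strict (R : realType) (Ri : pref R) x y := Ri x y /\ ~ Ri y x.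
Definition indiff (R : realType) (Ri : pref R) x y := Ri x y /\ Ri y x.

(* R_i \in U : a continuous complete preorder on [0,+oo]
   (the relation is required to vanish outside [0,+oo]). Continuity: upper and
   lower contour sets are closed in [0,+oo] (equivalently in \bar R, since
   [0,+oo] is closed). *)
Definition in_U (R : realType) (Ri : pref R) : Prop :=
  (forall x y, Ri x y -> Xdom x /\ Xdom y) /\
  (forall x y, Xdom x -> Xdom y -> Ri x y \/ Ri y x) /\
  (forall x y z, Ri x y -> Ri y z -> Ri x z) /\
  (forall y, Xdom y ->
     closed [set x | Xdom x /\ Ri x y] /\ closed [set x | Xdom x /\ Ri y x]).

Definition peak (R : realType) (Ri : pref R) : set (\bar R) :=
  [set x | Xdom x /\ forall y, Xdom y -> Ri x y].
Definition plo (R : realType) (Ri : pref R) : \bar R := ereal_inf (peak Ri).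
Definition phi (R : realType) (Ri : pref R) : \bar R := ereal_sup (peak Ri).

Definition single_peaked (R : realType) (Ri : pref R) : Prop :=
  in_U Ri /\ exists p : \bar R, peak Ri = [set p] /\
  forall x x' : R, 0 <= x -> 0 <= x' ->
    ((x' < x /\ (x%:E <= p)%E) \/ ((p <= x%:E)%E /\ x < x')) ->
    strict Ri x%:E x'%:E.

Definition single_plateaued (R : realType) (Ri : pref R) : Prop :=
  in_U Ri /\ peak Ri = [set x | (plo Ri <= x)%E /\ (x <= phi Ri)%E] /\
  forall x x' : R, 0 <= x -> 0 <= x' ->
    ((x' < x /\ (x%:E <= plo Ri)%E) \/ ((phi Ri <= x%:E)%E /\ x < x')) ->
    strict Ri x%:E x'%:E.

Definition U_dom (R : realType) : set (pref R) := [set Ri | in_U Ri].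
Definition SP_dom (R : realType) : set (pref R) := [set Ri | single_peaked Ri].
Definition SPL_dom (R : realType) : set (pref R) := [set Ri | single_plateaued Ri].

Definition profile (R : realType) (n : nat) := 'I_n -> pref R.

Definition economy (R : realType) (n : nat) (D : set (pref R))
  (Rp : profile R n) (Om : R) : Prop :=
  (forall i, D (Rp i)) /\ 0 < Om.

(* a rule: the map is total, but only its values on E_D matter *)
Definition rule (R : realType) (n : nat) := profile R n -> R -> 'I_n -> R.

Definition is_rule (R : realType) (n : nat) (D : set (pref R)) (f : rule R n) :=
  forall Rp Om, economy D Rp Om ->
    (forall i, 0 <= f Rp Om i) /\ \sum_(i < n) f Rp Om i = Om.

Definition upd (R : realType) (n : nat) (Rp : profile R n) (i : 'I_n) (Ri : pref R)
  : profile R n := fun j => if j == i then Ri else Rp j.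

Definition efficient (R : realType) (n : nat) (D : set (pref R)) (f : rule R n) :=
  forall Rp Om, economy D Rp Om ->
    ~ exists x : 'I_n -> R,
        (forall j, 0 <= x j) /\ \sum_(j < n) x j = Om /\
        (forall j, Rp j (x j)%:E (f Rp Om j)%:E) /\
        (exists j, strict (Rp j) (x j)%:E (f Rp Om j)%:E).

Definition own_peak_only (R : realType) (n : nat) (D : set (pref R)) (f : rule R n) :=
  forall Rp Om, economy D Rp Om -> forall i Ri', D Ri' ->
    peak Ri' = peak (Rp i) -> f Rp Om i = f (upd Rp i Ri') Om i.

Definition equal_division_guarantee (R : realType) (n : nat) (D : set (pref R))
  (f : rule R n) :=
  forall Rp Om, economy D Rp Om -> forall i,
    peak (Rp i) (Om / n%:R)%:E -> indiff (Rp i) (f Rp Om i)%:E (Om / n%:R)%:E.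

Definition others (R : realType) (n : nat) (D : set (pref R)) (Rp : profile R n)
  (i : 'I_n) := forall j, j != i -> D (Rp j).

Definition option_set (R : realType) (n : nat) (D : set (pref R)) (f : rule R n)
  (i : 'I_n) (Ri : pref R) (Om : R) : set R :=
  [set y | exists Rp, others D Rp i /\ y = f (upd Rp i Ri) Om i].

Definition manipulation (R : realType) (n : nat) (D : set (pref R)) (f : rule R n)
  (i : 'I_n) (Ri : pref R) (Om : R) (Ri' : pref R) :=
  D Ri' /\ exists Rp, others D Rp i /\
    strict Ri (f (upd Rp i Ri') Om i)%:E (f (upd Rp i Ri) Om i)%:E.

Definition obvious_manipulation (R : realType) (n : nat) (D : set (pref R))
  (f : rule R n) (i : 'I_n) (Ri : pref R) (Om : R) (Ri' : pref R) :=
  manipulation D f i Ri Om Ri' /\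
  forall x', option_set D f i Ri' Om x' ->
    exists x, option_set D f i Ri Om x /\ strict Ri x'%:E x%:E.

Definition NOM (R : realType) (n : nat) (D : set (pref R)) (f : rule R n) :=
  forall i Ri Om, D Ri -> 0 < Om ->
    forall Ri', ~ obvious_manipulation D f i Ri Om Ri'.

Definition good_rule (R : realType) (n : nat) (D : set (pref R)) (f : rule R n) :=
  is_rule D f /\ own_peak_only D f /\ efficient D f /\
  equal_division_guarantee D f /\ NOM D f.

(* Main.v *)
(* Reporting a single peak at Omega/n secures Omega/n by the guarantee, so NOM forces
   every agent to weakly prefer her share to Omega/n; conversely this lower bound gives
   NOM, because Omega/n lies in every option set.

   On SPL, the lower bound, efficiency and own-peak-onliness are met by an allocation
   depending only on the peaks, chosen between equal division and the peaks.

   Let a larger domain contain R0 outside SPL. Letting all agents but two peak at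
   M = Omega/n leaves 2M to be shared by R0 and one other agent. If the peak of R0 has a
   gap at c, the second agent peaks at 2M - c, where her preference can be tilted to
   either side without changing the outcome. If R0 fails to decrease away from its
   interval of peaks, own-peak-onliness makes it behave as a single-plateaued preference,
   which forces equal division, and equal division is then inefficient. *)
Require Import Defs.
From mathcomp Require Import all_boot all_order all_algebra.
From mathcomp Require Import all_classical all_reals all_analysis.
From mathcomp Require Import lra.
Import Order.TTheory GRing.Theory Num.Theory.
Import numFieldNormedType.Exports.
Local Open Scope classical_set_scope.
Local Open Scope ring_scope.
Set Implicit Arguments. Unset Strict Implicit. Unset Printing Implicit Defensive.

(** * Topology of the extended half-line and existence of peaks *)

Lemma nbhs_contract (R : realType) (x : \bar R) (A : set (\bar R)) :
  nbhs x A <-> exists2 e : R, 0 < e &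
    forall y, `|contract x - contract y| < e -> A y.
Proof.
rewrite -nbhs_ballE; split=> -[e e0 h]; exists e => // y hy; exact: h.
Qed.

Lemma contract_continuous (R : realType) : continuous (@contract R).
Proof.
move=> x; apply/cvgrPdist_lt => e e0; apply/nbhs_contract.
by exists e.
Qed.

Lemma closed_contract_le (R : realType) (h : R -> R) (k : R) :
  continuous h -> closed [set x : \bar R | h (contract x) <= k].
Proof.
move=> hc; apply: (@preimage_closed _ _ (h \o @contract R) [set y | y <= k]).
  by move=> x _; exact: (continuous_comp (@contract_continuous R x) (hc _)).
exact: (@closed_le R k).
Qed.

(** The infimum may be infinite, so adherence is tested after [contract], which is bounded and
    commutes with infima. *)
Lemma ereal_inf_closed (R : realType) (S : set (\bar R)) :
  S !=set0 -> closed S -> S (ereal_inf S).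
Proof.
move=> S0 cS; apply: cS => A /nbhs_contract[e e0 eA].
have hi : has_inf (@contract R @` S).
  split; first by case: S0 => x Sx; exists (contract x), x.
  exists (-1) => _ [x Sx <-].
  by have := contract_le1 x; rewrite ler_norml => /andP[].
have [_ [x Sx <-] xe] := inf_adherent e0 hi.
exists x; split => //; apply: eA; rewrite contract_inf//.
rewrite ler0_norm; first by lra.
rewrite subr_le0; apply: ge_inf; [by case: hi|by exists x].
Qed.

Lemma ereal_sup_closed (R : realType) (S : set (\bar R)) :
  S !=set0 -> closed S -> S (ereal_sup S).
Proof.
move=> S0 cS; apply: cS => A /nbhs_contract[e e0 eA].
have hi : has_sup (@contract R @` S).
  split; first by case: S0 => x Sx; exists (contract x), x.
  exists 1 => _ [x Sx <-].
  by have := contract_le1 x; rewrite ler_norml => /andP[].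
have [_ [x Sx <-] xe] := sup_adherent e0 hi.
exists x; split => //; apply: eA; rewrite contract_sup//.
rewrite ger0_norm; first by lra.
rewrite subr_ge0; apply: ub_le_sup; [by case: hi|by exists x].
Qed.

Lemma compact_Xdom (R : realType) : compact (@Xdom R).
Proof.
(* [expand] inverts [contract], which makes the half-line a continuous image of the unit
   interval. *)
have -> : @Xdom R = @expand R @` `[0, 1]%classic.
  apply/seteqP; split => [x x0|_ [y /= /[!in_itv]/= /andP[y0 y1] <-]].
    exists (contract x); last exact: contractK.
    rewrite /= in_itv/= -{1}(@contract0 R) le_contract x0/=.
    by have := contract_le1 x; rewrite ler_norml => /andP[].
  rewrite /Xdom /= -le_contract contract0 expandK// inE ler_norml y1 andbT; lra.
apply: continuous_compact; last exact: segment_compact.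
apply/subspace_continuousP => y /= /[!in_itv]/= /andP[y0 y1].
move=> A /nbhs_contract[e e0 eA]; apply/nbhs_ballP; exists e => //= z yz.
rewrite in_itv/= => /andP[z0 z1]; apply: eA.
by rewrite !expandK// inE ler_norml ?y1 ?z1 andbT; lra.
Qed.

(** Totality makes the upper contour sets a filter base. A cluster point exists by compactness and
    lies in each of them because they are closed. *)
Lemma peak_nonempty (R : realType) (Ri : pref R) : in_U Ri -> peak Ri !=set0.
Proof.
move=> [_ [tot [trans cl]]].
pose F := filter_from (@Xdom R) (fun y => [set x | Xdom x /\ Ri x y]).
have refl x : Xdom x -> Ri x x by move=> /[dup] hx /(tot _ _ hx)[].
have fF : ProperFilter F.
  apply: filter_from_proper; last by move=> y hy; exists y; split => //; exact: refl.
  apply: filter_from_filter; first by exists 0%E; rewrite /Xdom/=.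
  move=> x y hx hy; have [xy|yx] := tot _ _ hx hy; [exists x|exists y] => //.
    by move=> z [hz zx]; split => //; split => //; exact: trans zx xy.
  by move=> z [hz zx]; split => //; split => //; exact: trans zx yx.
have FX : F (@Xdom R) by exists 0%E; rewrite /Xdom//= => x [].
have [p [hp cp]] := @compact_Xdom R F fF FX.
exists p; split => // y hy.
have [|_ //] := (cl y hy).1 p; by move=> A pA; apply: cp => //; exists y.
Qed.

Lemma plo_ge0 (R : realType) (Ri : pref R) : (0 <= plo Ri)%E.
Proof. by apply: le_ereal_inf_tmp => x []. Qed.

Lemma plo_le_phi (R : realType) (Ri : pref R) : in_U Ri -> (plo Ri <= phi Ri)%E.
Proof.
move=> /peak_nonempty[p pp].
exact: le_trans (ereal_inf_lbound pp) (ereal_sup_ubound pp).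
Qed.

Lemma peak_closed (R : realType) (Ri : pref R) : in_U Ri -> closed (peak Ri).
Proof.
move=> [_ [_ [_ cl]]].
have -> : peak Ri = \bigcap_(y in @Xdom R) [set x | Xdom x /\ Ri x y].
  apply/seteqP; split=> [x [x0 hx] y hy|x hx]; first by split => //; exact: hx.
  split; last by move=> y /hx[].
  by have [] := hx 0%E (lexx _).
by apply: closed_bigI => y hy; exact: (cl y hy).1.
Qed.

(** * Tent-shaped preferences with a prescribed plateau *)

(* [g] is a disutility; [contract] embeds [\bar R] in [[-1, 1]], so that [g] need only be
   continuous on the reals. *)
Definition dispref (R : realType) (g : R -> R) : pref R := fun x y =>
  Xdom x /\ Xdom y /\ g (contract x) <= g (contract y).

Lemma dispref_in_U (R : realType) (g : R -> R) : continuous g -> in_U (dispref g).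
Proof.
move=> gc; split; first by move=> x y [? []].
split; first by move=> x y hx hy; case: (lerP (g (contract x)) (g (contract y)))
  => [?|/ltW ?]; [left|right].
split; first by move=> x y z [hx [hy xy]] [_ [hz yz]]; do !split => //; exact: le_trans yz.
move=> y hy; split.
- rewrite (_ : mkset _ = @Xdom R `&` [set x | g (contract x) <= g (contract y)]).
    by apply: closedI; [exact: closed_ereal_le_ereal|exact: closed_contract_le].
  by apply/seteqP; split => x /= [hx]; [case=> _ []|].
- rewrite (_ : mkset _ = @Xdom R `&`
      [set x | (fun z => - g z) (contract x) <= - g (contract y)]).
    apply: closedI; first exact: closed_ereal_le_ereal.
    apply: (@closed_contract_le R (fun z => - g z)).
    by move=> x; apply: cvgN; exact: gc.
  by apply/seteqP; split => x /= [hx]; rewrite lerN2; [case=> _ []|].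
Qed.

Lemma dispref_strict (R : realType) (g : R -> R) x y : Xdom x -> Xdom y ->
  strict (dispref g) x y <-> g (contract x) < g (contract y).
Proof.
move=> hx hy; rewrite ltNge; split=> [[_ h]|/negP h].
  by apply/negP => h1; apply: h.
split; last by move=> [_ [_]].
by split => //; split => //; rewrite leNgt; apply/negP => /ltW.
Qed.

Section dip.
Context (R : realType) (k l a b : R).

(** The distance to the interval from [a] to [b], weighted by [k] on its left and by [l] on its
    right. *)
Definition dip (z : R) : R :=
  Num.max 0 (Num.max (k * (a - z)) (l * (z - b))).

Lemma dip_continuous : continuous dip.
Proof.
move=> z.
pose u := (fun z : R => k * (a - z)) : R -> R^o.
pose v := (fun z : R => l * (z - b)) : R -> R^o.
apply: (@continuous_max R R (fun _ : R => 0 : R^o) (u \max v)); first exact: cvg_cst.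
apply: continuous_max; apply: cvgM; try exact: cvg_cst.
  by apply: cvgB; [exact: cvg_cst|exact: cvg_id].
by apply: cvgB; [exact: cvg_id|exact: cvg_cst].
Qed.

Hypotheses (k0 : 0 < k) (l0 : 0 < l) (ab : a <= b).

Lemma dip_ge0 z : 0 <= dip z. Proof. by rewrite le_max lexx. Qed.

Lemma dip_le0 z : (dip z <= 0) = (a <= z <= b).
Proof. by rewrite ge_max lexx ge_max !pmulr_rle0// !subr_le0. Qed.

Lemma dip_left z : z <= a -> dip z = k * (a - z).
Proof.
move=> za; rewrite /dip (max_l (_ : l * (z - b) <= k * (a - z))) ?max_r//.
  by rewrite mulr_ge0 ?(ltW k0)// subr_ge0.
apply: (@le_trans _ _ 0); last by rewrite mulr_ge0 ?(ltW k0)// subr_ge0.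
by rewrite pmulr_rle0// subr_le0 (le_trans za).
Qed.

Lemma dip_right z : b <= z -> dip z = l * (z - b).
Proof.
move=> bz; rewrite /dip (max_r (_ : k * (a - z) <= l * (z - b))) ?max_r//.
  by rewrite mulr_ge0 ?(ltW l0)// subr_ge0.
apply: (@le_trans _ _ 0); last by rewrite mulr_ge0 ?(ltW l0)// subr_ge0.
by rewrite pmulr_rle0// subr_le0 (le_trans ab).
Qed.

End dip.

(** The slopes [k] and [l] leave the peak alone, so they can be tuned while own-peak-onliness keeps
    the outcome fixed. *)
Definition tent (R : realType) (k l : R) (lo hi : \bar R) : pref R :=
  dispref (dip k l (contract lo) (contract hi)).

Section tent.
Context (R : realType) (k l : R) (lo hi : \bar R).
Hypotheses (k0 : 0 < k) (l0 : 0 < l) (lo0 : (0 <= lo)%E) (lohi : (lo <= hi)%E).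

Let clohi : contract lo <= contract hi. Proof. by rewrite le_contract. Qed.

Lemma peak_tent : peak (tent k l lo hi) = [set x | (lo <= x)%E /\ (x <= hi)%E].
Proof.
apply/seteqP; split => x.
  move=> [x0 /(_ lo lo0)[_ [_]]] h.
  have : dip k l (contract lo) (contract hi) (contract x) <= 0.
    by apply: le_trans h _; rewrite dip_le0// lexx.
  by rewrite dip_le0// !le_contract => /andP[].
move=> [lx xh]; split; first exact: le_trans lx.
move=> y y0; split; first exact: le_trans lx.
split => //; apply: le_trans (dip_ge0 _ _ _ _ _).
by rewrite dip_le0// !le_contract lx.
Qed.

Lemma plo_tent : plo (tent k l lo hi) = lo.
Proof.
rewrite /plo peak_tent; apply/eqP; rewrite eq_le; apply/andP; split.
  by apply: ereal_inf_lbound; split => //=.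
by apply: le_ereal_inf_tmp => x [].
Qed.

Lemma phi_tent : phi (tent k l lo hi) = hi.
Proof.
rewrite /phi peak_tent; apply/eqP; rewrite eq_le; apply/andP; split.
  by apply: ge_ereal_sup => x [].
by apply: ereal_sup_ubound; split => //=.
Qed.

Lemma tent_SPL : SPL_dom (tent k l lo hi).
Proof.
split; first by apply: dispref_in_U; exact: dip_continuous.
split; first by rewrite plo_tent phi_tent peak_tent.
rewrite plo_tent phi_tent => x x' x0 x'0 h.
apply/dispref_strict; rewrite /Xdom/= ?lee_fin//.
case: h => [[xx xl]|[xh xx]].
- have cx : contract x'%:E < contract x%:E by rewrite lt_contract lte_fin.
  have cl : contract x%:E <= contract lo by rewrite le_contract.
  rewrite !dip_left ?(le_trans (ltW cx))//.
  by rewrite ltr_pM2l// ltrD2l ltrN2.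
- have cx : contract x%:E < contract x'%:E by rewrite lt_contract lte_fin.
  have cl : contract hi <= contract x%:E by rewrite le_contract.
  rewrite !dip_right ?(le_trans _ (ltW cx))//.
  by rewrite ltr_pM2l// ltrD2r.
Qed.

End tent.

(** A peak does not decide how points on opposite sides of it compare; [no_gap] exploits this
    freedom, here and in [steep_right]. *)
Lemma steep_left (R : realType) (s q t : R) : 0 <= s -> s < q -> q < t ->
  exists Ri : pref R, [/\ SPL_dom Ri,
    peak Ri = peak (tent 1 1 q%:E q%:E) & strict Ri t%:E s%:E].
Proof.
move=> s0 sq qt.
have q0 : 0 <= q by lra.
have A : 0 < contract q%:E - contract s%:E by rewrite subr_gt0 lt_contract lte_fin.
have B : 0 < contract t%:E - contract q%:E by rewrite subr_gt0 lt_contract lte_fin.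
have B2 : 0 < 2 * (contract t%:E - contract q%:E) by rewrite mulr_gt0.
(* Each slope is the embedded distance on the other side, which would balance the two disutilities;
   the factor 2 makes [s] the worse point. *)
exists (tent (2 * (contract t%:E - contract q%:E)) (contract q%:E - contract s%:E)
  q%:E q%:E).
split; [exact: tent_SPL|by rewrite !peak_tent|].
apply/dispref_strict; rewrite /Xdom/= ?lee_fin//; first by lra.
rewrite (@dip_left _ _ _ _ _ _ _ _ (contract s%:E))//; last by rewrite -subr_ge0 ltW.
rewrite (@dip_right _ _ _ _ _ _ _ _ (contract t%:E))//; last by rewrite -subr_ge0 ltW.
by rewrite mulrC -mulrA ltr_pMl ?ltr1n// mulr_gt0.
Qed.

Lemma steep_right (R : realType) (s q t : R) : 0 <= s -> s < q -> q < t ->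
  exists Ri : pref R, [/\ SPL_dom Ri,
    peak Ri = peak (tent 1 1 q%:E q%:E) & strict Ri s%:E t%:E].
Proof.
move=> s0 sq qt.
have q0 : 0 <= q by lra.
have A : 0 < contract q%:E - contract s%:E by rewrite subr_gt0 lt_contract lte_fin.
have B : 0 < contract t%:E - contract q%:E by rewrite subr_gt0 lt_contract lte_fin.
have A2 : 0 < 2 * (contract q%:E - contract s%:E) by rewrite mulr_gt0.
exists (tent (contract t%:E - contract q%:E) (2 * (contract q%:E - contract s%:E))
  q%:E q%:E).
split; [exact: tent_SPL|by rewrite !peak_tent|].
apply/dispref_strict; rewrite /Xdom/= ?lee_fin//; first by lra.
rewrite (@dip_left _ _ _ _ _ _ _ _ (contract s%:E))//; last by rewrite -subr_ge0 ltW.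
rewrite (@dip_right _ _ _ _ _ _ _ _ (contract t%:E))//; last by rewrite -subr_ge0 ltW.
by rewrite mulrC -mulrA ltr_pMl ?ltr1n// mulr_gt0.
Qed.

(** * Existence of fair allocations *)

Lemma interpolate (R : realType) (n : nat) (u v : 'I_n -> R) (Om : R) :
  (forall i, u i <= v i) -> \sum_(i < n) u i <= Om -> Om <= \sum_(i < n) v i ->
  exists2 x : 'I_n -> R, forall i, u i <= x i <= v i & \sum_(i < n) x i = Om.
Proof.
move=> uv su sv.
set U := \sum_(i < n) u i in su *; set V := \sum_(i < n) v i in sv *.
have [UV|UV] := eqVneq U V.
  exists u => [i|]; first by rewrite lexx uv.
  by apply/eqP; rewrite eq_le su/= -/U UV.
have dpos : 0 < V - U by rewrite subr_gt0 lt_neqAle UV (le_trans su sv).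
pose t := (Om - U) / (V - U).
have t0 : 0 <= t by apply: divr_ge0; [rewrite subr_ge0|exact: ltW].
have t1 : t <= 1 by rewrite ler_pdivrMr// mul1r lerD2r.
exists (fun i => u i + t * (v i - u i)) => [i|].
  have := uv i; rewrite -subr_ge0 => h; apply/andP; split; first by rewrite lerDl mulr_ge0.
  by rewrite -lerBrDl ler_piMl.
by rewrite big_split/= -mulr_sumr sumrB -/U -/V /t divfK ?gt_eqF// addrC subrK.
Qed.

Lemma sum_le_eq (R : realType) (n : nat) (x y : 'I_n -> R) :
  (forall i, x i <= y i) -> \sum_(i < n) x i = \sum_(i < n) y i ->
  forall i, x i = y i.
Proof.
move=> xy /eqP; rewrite eq_sym -subr_eq0 -sumrB => /eqP s0 i.
have d0 j : true -> 0 <= y j - x j by rewrite subr_ge0.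
by have /eqP := psumr_eq0P d0 s0 (i := i) isT; rewrite subr_eq0 => /eqP.
Qed.

(* The three cases are excess demand, satiation and excess supply. In the first
   and the third, every agent lies between the equal share and the peak. *)
Definition fair_allocation (R : realType) (n : nat) (lo hi : 'I_n -> \bar R)
    (Om : R) (x : 'I_n -> R) : Prop :=
  [/\ forall i, 0 <= x i, \sum_(i < n) x i = Om &
  [\/ forall i, (mine (lo i) (Om / n%:R)%:E <= (x i)%:E <= lo i)%E,
      forall i, (lo i <= (x i)%:E <= hi i)%E |
      forall i, (hi i <= (x i)%:E <= maxe (hi i) (Om / n%:R)%:E)%E]].

Lemma sum_equal_division (R : realType) (n : nat) (Om : R) :
  (0 < n)%N -> \sum_(i < n) (Om / n%:R) = Om.
Proof.
move=> n0; rewrite sumr_const card_ord -[_ *+ n]mulr_natr divfK//.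
by rewrite pnatr_eq0 -lt0n.
Qed.

Lemma fair_allocation_exists (R : realType) (n : nat) (lo hi : 'I_n -> \bar R)
    (Om : R) : (0 < n)%N -> 0 < Om -> (forall i, 0 <= lo i)%E ->
  (forall i, lo i <= hi i)%E -> exists x, fair_allocation lo hi Om x.
Proof.
move=> n0 Om0 lo0 lohi.
pose e := Om / n%:R.
have e0 : 0 <= e by rewrite divr_ge0// ltW.
have se : \sum_(i < n) e = Om by exact: sum_equal_division.
have eOm : e <= Om by rewrite ler_pdivrMr ?ltr0n// ler_peMr ?ler1n// ltW.
(* Peaks may be infinite; cutting them at [Om] gives real bounds for [interpolate]. *)
pose cap (z : \bar R) := fine (mine z Om%:E).
have capE z : (0 <= z)%E -> (cap z)%:E = mine z Om%:E.
  move=> z0; rewrite fineK// fin_numE minEle; case: ifP => h; rewrite ?ltNye//.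
  by rewrite -ltNye (lt_le_trans _ z0)//= -ltey (le_lt_trans h)// ltry.
have cap0 z : (0 <= z)%E -> 0 <= cap z.
  by move=> z0; rewrite -lee_fin capE// le_min z0 lee_fin ltW.
have capOm z : (0 <= z)%E -> cap z <= Om.
  by move=> z0; rewrite -lee_fin capE// ge_min lexx orbT.
have caple z : (0 <= z)%E -> ((cap z)%:E <= z)%E.
  by move=> z0; rewrite capE// ge_min lexx.
have cap_id z : (0 <= z)%E -> cap z < Om -> z = (cap z)%:E.
  move=> z0; rewrite -lte_fin capE// => h; rewrite min_l//.
  by move: h; rewrite gt_min ltxx orbF => /ltW.
have hi0 i : (0 <= hi i)%E by apply: le_trans (lohi i).
have ab i : cap (lo i) <= cap (hi i).
  by rewrite -lee_fin !capE// le_min2.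
(* When the cut peaks sum to less than [Om], none of them was really cut. *)
have small (z : 'I_n -> \bar R) : (forall i, 0 <= z i)%E ->
    \sum_(i < n) cap (z i) < Om -> forall i, z i = (cap (z i))%:E.
  move=> z0 sz i; apply: cap_id => //; apply: le_lt_trans sz.
  by rewrite (bigD1 i)//= lerDl sumr_ge0// => j _; exact: cap0.
have [sa|sa] := leP Om (\sum_(i < n) cap (lo i)).
  (* The lower bounds sum to at most [n] equal shares, that is [Om]. Excess supply is dual. *)
  have ma i : Num.min (cap (lo i)) e <= cap (lo i) by rewrite ge_min lexx.
  have me : \sum_(i < n) Num.min (cap (lo i)) e <= Om.
    by rewrite -[leRHS]se; apply: ler_sum => i _; rewrite ge_min lexx orbT.
  have [x xl xs] := interpolate ma me sa.
  exists x; split => //.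
    move=> i; have /andP[+ _] := xl i; apply: le_trans; by rewrite le_min cap0.
  apply: Or31 => i; have /andP[h1 h2] := xl i; apply/andP; split.
    apply: (@le_trans _ _ (Num.min (cap (lo i)) e)%:E); last by rewrite lee_fin.
    rewrite EFin_min capE// -minA !le_min !ge_min !lexx/= !lee_fin eOm.
    by rewrite !orbT.
  by apply: le_trans (caple _ (lo0 i)); rewrite lee_fin.
have loE := small lo lo0 sa.
have [sb|sb] := leP Om (\sum_(i < n) cap (hi i)).
  have [x xl xs] := interpolate ab (ltW sa) sb.
  exists x; split => //.
    by move=> i; have /andP[+ _] := xl i; apply: le_trans; exact: cap0.
  apply: Or32 => i; have /andP[h1 h2] := xl i.
  by rewrite loE lee_fin h1/=; apply: le_trans (caple _ (hi0 i)); rewrite lee_fin.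
have hiE := small hi hi0 sb.
have bm i : cap (hi i) <= Num.max (cap (hi i)) e by rewrite le_max lexx.
have em : Om <= \sum_(i < n) Num.max (cap (hi i)) e.
  by rewrite -[leLHS]se; apply: ler_sum => i _; rewrite le_max lexx orbT.
have [x xl xs] := interpolate bm (ltW sb) em.
exists x; split => //.
  by move=> i; have /andP[+ _] := xl i; apply: le_trans; exact: cap0.
by apply: Or33 => i; have /andP[h1 h2] := xl i; rewrite hiE -EFin_max !lee_fin h1.
Qed.

(** * Point peaks, profile updates and sums *)

Definition sp_at (R : realType) (q : R) : pref R := tent 1 1 q%:E q%:E.

Lemma sp_at_SPL (R : realType) (q : R) : 0 <= q -> SPL_dom (sp_at q).
Proof. by move=> q0; apply: tent_SPL; rewrite ?lee_fin. Qed.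

Lemma peak_sp_at (R : realType) (q : R) : 0 <= q -> peak (sp_at q) = [set q%:E].
Proof.
move=> q0; rewrite peak_tent ?lee_fin//.
apply/seteqP; split => [x /= [h1 h2]|x ->//].
by apply/eqP; rewrite eq_le h1 h2.
Qed.

Lemma not_pref_strict (R : realType) (Ri : pref R) x y :
  in_U Ri -> Xdom x -> Xdom y -> ~ Ri y x -> strict Ri x y.
Proof. by move=> [_ [tot _]] hx hy nyx; split => //; have [] := tot _ _ hx hy. Qed.

Lemma upd_id (R : realType) (n : nat) (Rp : profile R n) i : upd Rp i (Rp i) = Rp.
Proof. by apply/funext => j; rewrite /upd; case: eqP => [->|]. Qed.

Lemma economy_upd (R : realType) (n : nat) (D : set (pref R)) (Rp : profile R n)
  (Om : R) i Ri : others D Rp i -> D Ri -> 0 < Om -> economy D (upd Rp i Ri) Om.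
Proof.
by move=> oD Di Om0; split => // j; rewrite /upd; case: eqP => // /eqP; exact: oD.
Qed.

Lemma sum_eq_rest1 (R : realType) (n : nat) (x y : 'I_n -> R) i :
  (forall j, j != i -> x j = y j) ->
  (\sum_(j < n) x j = \sum_(j < n) y j <-> x i = y i).
Proof.
move=> xy; rewrite (bigD1 i)//= [in X in _ = X](bigD1 i)//= (eq_bigr y xy).
by split=> [/addIr|->].
Qed.

Lemma sum_eq_rest2 (R : realType) (n : nat) (x y : 'I_n -> R) i k : k != i ->
  (forall j, j != i -> j != k -> x j = y j) ->
  (\sum_(j < n) x j = \sum_(j < n) y j <-> x i + x k = y i + y k).
Proof.
move=> ki xy; rewrite (bigD1 i)//= (bigD1 k)//= addrA.
rewrite [in X in _ = X](bigD1 i)//= [in X in _ = X](bigD1 k)//= addrA.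
rewrite (eq_bigr y); last by move=> j /andP[]; exact: xy.
by split=> [/addIr|->].
Qed.

(** * The equal-division lower bound and NOM *)

Definition equal_division_lower_bound (R : realType) (n : nat) (D : set (pref R))
    (f : rule R n) : Prop :=
  forall Rp Om, economy D Rp Om -> forall i,
    Rp i (f Rp Om i)%:E (Om / n%:R)%:E.

Section rules.
Context (R : realType) (n : nat) (D : set (pref R)) (f : rule R n).
Hypotheses (n0 : (0 < n)%N) (SPLD : @SPL_dom R `<=` D) (DU : D `<=` @U_dom R).

Lemma equal_division_ge0 (Om : R) : 0 < Om -> 0 <= Om / n%:R.
Proof. by move=> h; rewrite divr_ge0// ltW. Qed.

(** Indifference to a peak point makes the share itself a peak point, and the peak has only one. *)
Lemma guarantee_exact : equal_division_guarantee D f ->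
  forall Rp Om i, economy D Rp Om -> peak (Rp i) = [set (Om / n%:R)%:E] ->
  f Rp Om i = Om / n%:R.
Proof.
move=> edg Rp Om i eRp pk.
have pe : peak (Rp i) (Om / n%:R)%:E by rewrite pk.
have [h _] := edg _ _ eRp i pe.
have [sub [_ [tr _]]] := DU (eRp.1 i).
suff: peak (Rp i) (f Rp Om i)%:E by rewrite pk => -[].
split; first exact: (sub _ _ h).1.
by move=> y y0; apply: tr h _; exact: pe.2.
Qed.

Lemma lower_bound_guarantee :
  equal_division_lower_bound D f -> is_rule D f -> equal_division_guarantee D f.
Proof.
move=> lb fr Rp Om eRp i pe; split; first exact: lb.
by apply: pe.2; rewrite /Xdom/= lee_fin; exact: (fr _ _ eRp).1.
Qed.

(* When all the others peak at the equal share, the agent is left with it whatever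
   she reports, so the equal share belongs to every option set. *)
Lemma lower_bound_NOM : equal_division_lower_bound D f -> is_rule D f -> NOM D f.
Proof.
move=> lb fr i Ri Om DRi Om0 Ri' [[DRi' _] om].
have e0 := equal_division_ge0 Om0.
pose T := sp_at (Om / n%:R).
have DT : D T by apply: SPLD; exact: sp_at_SPL.
have oT : others D (fun=> T) i by [].
have eT := economy_upd oT DRi' Om0.
have fi : f (upd (fun=> T) i Ri') Om i = Om / n%:R.
  rewrite -(sum_eq_rest1 (y := fun=> Om / n%:R)) => [|j ji].
    by rewrite sum_equal_division// (fr _ _ eT).2.
  apply: (guarantee_exact (lower_bound_guarantee lb fr) eT).
  by rewrite /upd (negbTE ji) peak_sp_at.
(* The equal share is an option of [Ri'], so obviousness yields an option of [Ri] strictly worse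
   than it, against the lower bound. *)
have [|x [[Rp [oRp ->]] [_]]] := om (Om / n%:R).
  by exists (fun=> T); split.
apply; have := lb _ _ (economy_upd oRp DRi Om0) i.
by rewrite {1}/upd eqxx.
Qed.

(** The report [T] has the equal share as its only option, so it is an obvious manipulation as soon
    as it is a manipulation. *)
Lemma NOM_lower_bound : NOM D f -> is_rule D f -> equal_division_guarantee D f ->
  equal_division_lower_bound D f.
Proof.
move=> nom fr edg Rp Om eRp i.
have [DRp Om0] := eRp.
have e0 := equal_division_ge0 Om0.
pose T := sp_at (Om / n%:R).
have DT : D T by apply: SPLD; exact: sp_at_SPL.
have fT Rp' : others D Rp' i -> f (upd Rp' i T) Om i = Om / n%:R.
  move=> oR; apply: (guarantee_exact edg); first exact: economy_upd.
  by rewrite /upd eqxx peak_sp_at.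
have oRp : others D Rp i by move=> j _; exact: DRp.
have [h|h] := pselect (Rp i (f Rp Om i)%:E (Om / n%:R)%:E); first by [].
have st : strict (Rp i) (Om / n%:R)%:E (f Rp Om i)%:E.
  apply: not_pref_strict => //; first exact: DU.
  by rewrite /Xdom/= lee_fin; exact: (fr _ _ eRp).1.
exfalso; apply: (nom i (Rp i) Om (DRp i) Om0 T); split.
  by split => //; exists Rp; split => //; rewrite upd_id fT.
move=> _ [Rp' [oR ->]]; exists (f Rp Om i); rewrite fT//; split => //.
by exists Rp; rewrite upd_id.
Qed.

End rules.

(** * A rule on the single-plateaued domain *)

Section single_plateaued.
Context (R : realType) (Ri : pref R) (Ri_SPL : SPL_dom Ri).

Lemma SPL_in_U : in_U Ri. Proof. by case: Ri_SPL. Qed.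

Lemma SPL_refl x : Xdom x -> Ri x x.
Proof. by move=> hx; have [_ [/(_ x x hx hx)[]]] := SPL_in_U. Qed.

Lemma SPL_peak x y : (plo Ri <= x)%E -> (x <= phi Ri)%E -> Xdom y -> Ri x y.
Proof.
have [_ [pE _]] := Ri_SPL; move=> h1 h2 hy.
by have [_] : peak Ri x; [rewrite pE|apply].
Qed.

Lemma SPL_below (x y : R) : 0 <= y -> y <= x -> (x%:E <= plo Ri)%E -> Ri x%:E y%:E.
Proof.
move=> y0; rewrite le_eqVlt => /predU1P[<- _|yx xl]; first by apply: SPL_refl; rewrite /Xdom/= lee_fin.
have x0 := le_trans y0 (ltW yx).
by have [_ [_ /(_ x y x0 y0)[|//]]] := Ri_SPL; left.
Qed.

Lemma SPL_above (x y : R) : 0 <= x -> x <= y -> (phi Ri <= x%:E)%E -> Ri x%:E y%:E.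
Proof.
move=> x0; rewrite le_eqVlt => /predU1P[<- _|xy xl]; first by apply: SPL_refl; rewrite /Xdom/= lee_fin.
have y0 := le_trans x0 (ltW xy).
by have [_ [_ /(_ x y x0 y0)[|//]]] := Ri_SPL; right.
Qed.

Lemma SPL_pref_below (x y : R) : 0 <= x -> 0 <= y -> (x%:E <= plo Ri)%E ->
  Ri y%:E x%:E -> x <= y.
Proof.
move=> x0 y0 xl yx; rewrite leNgt; apply/negP => yltx.
by have [_ [_ /(_ x y x0 y0)[|//]]] := Ri_SPL; left.
Qed.

Lemma SPL_pref_above (x y : R) : 0 <= x -> 0 <= y -> (phi Ri <= x%:E)%E ->
  Ri y%:E x%:E -> y <= x.
Proof.
move=> x0 y0 xl yx; rewrite leNgt; apply/negP => yltx.
by have [_ [_ /(_ x y x0 y0)[|//]]] := Ri_SPL; right.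
Qed.

End single_plateaued.

(** [xget] chooses from a set that depends only on the ends of the peaks, hence own-peak-onliness.
    By [fair_ruleP] the default 0 does not matter on single-plateaued economies. *)
Definition fair_rule (R : realType) (n : nat) : rule R n := fun Rp Om =>
  xget (fun=> 0)
    [set x | fair_allocation (fun j => plo (Rp j)) (fun j => phi (Rp j)) Om x].

Section fair_rule.
Context (R : realType) (n : nat) (n0 : (0 < n)%N).

Lemma fair_ruleP (Rp : profile R n) Om : economy (@SPL_dom R) Rp Om ->
  fair_allocation (fun j => plo (Rp j)) (fun j => phi (Rp j)) Om (fair_rule Rp Om).
Proof.
move=> [SPLR Om0]; rewrite /fair_rule.
have [x hx] := fair_allocation_exists n0 Om0 (fun i => plo_ge0 (Rp i))
  (fun i => plo_le_phi (SPL_in_U (SPLR i))).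
exact: (@xgetPex _ (fun=> 0) _ (ex_intro _ x hx)).
Qed.

Lemma fair_rule_lower_bound :
  equal_division_lower_bound (@SPL_dom R) (@fair_rule R n).
Proof.
move=> Rp Om eRp i; have [f0 _ cases] := fair_ruleP eRp.
have SPLi := eRp.1 i.
have e0 : 0 <= Om / n%:R by apply: equal_division_ge0; exact: eRp.2.
case: cases => /(_ i)/andP[h1 h2].
(* Either the share reaches the plateau, or it lies between the equal share and the plateau, where
   the preference is monotone. *)
- move: h1; rewrite ge_min => /orP[h1|]; last by rewrite lee_fin => h1; exact: SPL_below.
  by apply: SPL_peak => //; apply: le_trans h2 (plo_le_phi (SPL_in_U SPLi)).
- exact: SPL_peak.
- move: h2; rewrite le_max => /orP[h2|]; last by rewrite lee_fin => h2; exact: SPL_above.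
  by apply: SPL_peak => //; apply: le_trans (plo_le_phi (SPL_in_U SPLi)) h1.
Qed.

Lemma fair_rule_good : good_rule (@SPL_dom R) (@fair_rule R n).
Proof.
have fr : is_rule (@SPL_dom R) (@fair_rule R n).
  by move=> Rp Om /fair_ruleP[].
have lb := fair_rule_lower_bound.
split => //; split.
  move=> Rp Om eRp i Ri' _ pk; rewrite /fair_rule.
  have plE j : plo (upd Rp i Ri' j) = plo (Rp j).
    by rewrite /upd; case: eqP => // ->; rewrite /plo pk.
  have phE j : phi (upd Rp i Ri' j) = phi (Rp j).
    by rewrite /upd; case: eqP => // ->; rewrite /phi pk.
  by rewrite (funext plE) (funext phE).
split.
  move=> Rp Om eRp [x [x0 [sx [wx [k [kx nkx]]]]]].
  have SPLR := eRp.1.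
  have [f0 sf cases] := fair_ruleP eRp.
  have {}sx : \sum_(j < n) fair_rule Rp Om j = \sum_(j < n) x j by rewrite sx.
  case: cases => h.
  (* No share exceeds the lower end of its plateau, so a Pareto improvement gives each agent at
     least as much; equal sums then make it the same allocation. *)
  - have fx j : fair_rule Rp Om j <= x j.
      by have /andP[_ ?] := h j; apply: (SPL_pref_below (SPLR j)).
    by apply: nkx; rewrite (sum_le_eq fx sx) in kx *.
  - by apply: nkx; have /andP[? ?] := h k; apply: SPL_peak => //; exact: x0.
  - have xf j : x j <= fair_rule Rp Om j.
      by have /andP[? _] := h j; apply: (SPL_pref_above (SPLR j)).
    by apply: nkx; rewrite -(sum_le_eq xf (esym sx)) in kx *.
split; first exact: lower_bound_guarantee.
apply: lower_bound_NOM => // Ri; exact: SPL_in_U.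
Qed.

End fair_rule.

(** * Reduction to two agents *)

(* What is left of a rule when all agents but two peak at the equal share [M]:
   the first of the two gets [g R0 T M] and the second the rest of [2 M]. *)
Record two_agent_rule (R : realType) (D : set (pref R))
    (g : pref R -> pref R -> R -> R) : Prop := TwoAgentRule {
  tar_bounds : forall R0 T M, D R0 -> D T -> 0 < M -> 0 <= g R0 T M <= 2 * M;
  tar_lower1 : forall R0 T M, D R0 -> D T -> 0 < M -> R0 (g R0 T M)%:E M%:E;
  tar_lower2 : forall R0 T M, D R0 -> D T -> 0 < M ->
    T (2 * M - g R0 T M)%:E M%:E;
  tar_efficient : forall R0 T M a, D R0 -> D T -> 0 < M -> 0 <= a <= 2 * M ->
    R0 a%:E (g R0 T M)%:E -> ~ strict T (2 * M - a)%:E (2 * M - g R0 T M)%:E;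
  tar_peak1 : forall R0 R1 T M, D R0 -> D R1 -> D T -> 0 < M ->
    peak R1 = peak R0 -> g R0 T M = g R1 T M;
  tar_peak2 : forall R0 T T1 M, D R0 -> D T -> D T1 -> 0 < M ->
    peak T1 = peak T -> g R0 T M = g R0 T1 M }.

Definition two_agent_profile (R : realType) (n : nat) (i k : 'I_n)
    (R0 T : pref R) (M : R) : profile R n :=
  upd (upd (fun=> sp_at M) k T) i R0.

(** The guarantee pins every other agent at [M], so the properties of [f] restrict to the pair
    sharing [2 * M]. *)
Lemma good_rule_two_agents (R : realType) (n : nat) (D : set (pref R))
    (f : rule R n) (i k : 'I_n) : @SPL_dom R `<=` D -> D `<=` @U_dom R ->
  good_rule D f -> k != i ->
  two_agent_rule D (fun R0 T M =>
    f (two_agent_profile i k R0 T M) (M * n%:R) i).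
Proof.
move=> SPLD DU [fr [op [eff [edg nom]]]] ki.
have n0 : (0 < n)%N by apply: leq_ltn_trans (ltn_ord i).
have lb := NOM_lower_bound SPLD DU nom fr edg.
have Mn (M : R) : M * n%:R / n%:R = M by rewrite mulfK// pnatr_eq0 -lt0n.
have Pi (R0 T : pref R) (M : R) : two_agent_profile i k R0 T M i = R0.
  by rewrite /two_agent_profile /upd eqxx.
have Pk (R0 T : pref R) (M : R) : two_agent_profile i k R0 T M k = T.
  by rewrite /two_agent_profile /upd (negbTE ki) eqxx.
have Pj (R0 T : pref R) (M : R) j : j != i -> j != k -> two_agent_profile i k R0 T M j = sp_at M.
  by rewrite /two_agent_profile /upd => /negbTE-> /negbTE->.
have eco (R0 T : pref R) (M : R) : D R0 -> D T -> 0 < M ->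
    economy D (two_agent_profile i k R0 T M) (M * n%:R).
  move=> DR0 DT M0; split; last by rewrite mulr_gt0// ltr0n.
  move=> j; rewrite /two_agent_profile /upd; case: eqP => // _; case: eqP => // _.
  by apply: SPLD; apply: sp_at_SPL; exact: ltW.
have rest (M : R) (x : 'I_n -> R) : (forall j, j != i -> j != k -> x j = M) ->
    (\sum_(j < n) x j = M * n%:R <-> x i + x k = 2 * M).
  move=> xM.
  have := @sum_eq_rest2 R n x (fun=> M) i k ki xM.
  by rewrite sumr_const card_ord mulr_natr mulrDl mul1r.
have fj (R0 T : pref R) (M : R) j : D R0 -> D T -> 0 < M -> j != i -> j != k ->
    f (two_agent_profile i k R0 T M) (M * n%:R) j = M.
  move=> DR0 DT M0 ji jk.
  rewrite (guarantee_exact DU edg (eco _ _ _ DR0 DT M0)) ?Mn// Pj// peak_sp_at ?ltW//.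
have fk (R0 T : pref R) (M : R) : D R0 -> D T -> 0 < M ->
    f (two_agent_profile i k R0 T M) (M * n%:R) k =
    2 * M - f (two_agent_profile i k R0 T M) (M * n%:R) i.
  move=> DR0 DT M0; have [_ sf] := fr _ _ (eco _ _ _ DR0 DT M0).
  have E := (rest M _ (fun j => fj R0 T M j DR0 DT M0)).1 sf.
  by rewrite -E addrAC subrr add0r.
split=> [R0 T M DR0 DT M0|R0 T M DR0 DT M0|R0 T M DR0 DT M0|R0 T M a DR0 DT M0 a01
  |R0 R1 T M DR0 DR1 DT M0 pk|R0 T T1 M DR0 DT DT1 M0 pk].
- have [f0 _] := fr _ _ (eco _ _ _ DR0 DT M0).
  by rewrite f0/= -subr_ge0 -fk//; exact: f0.
- by have := lb _ _ (eco _ _ _ DR0 DT M0) i; rewrite Pi Mn.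
- by have := lb _ _ (eco _ _ _ DR0 DT M0) k; rewrite Pk Mn -fk.
- move=> Ra Tst; have /andP[a0 a1] := a01.
  apply: (eff _ _ (eco _ _ _ DR0 DT M0)).
  pose y j := if j == i then a else if j == k then 2 * M - a else M.
  have yi : y i = a by rewrite /y eqxx.
  have yk : y k = 2 * M - a by rewrite /y (negbTE ki) eqxx.
  have yj j : j != i -> j != k -> y j = M by rewrite /y => /negbTE-> /negbTE->.
  exists y; split.
    move=> j; rewrite /y; case: eqP => // _; case: eqP => // _; last exact: ltW.
    by rewrite subr_ge0.
  split; first by apply/rest => //; rewrite yi yk addrC subrK.
  split; last by exists k; rewrite Pk yk fk.
  move=> j; have [->|ji] := eqVneq j i; first by rewrite Pi yi.
  have [->|jk] := eqVneq j k; first by rewrite Pk yk fk//; exact: Tst.1.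
  rewrite yj// fj// Pj//; apply: SPL_refl; first by apply: sp_at_SPL; exact: ltW.
  by rewrite /Xdom/= lee_fin ltW.
- rewrite (op _ _ (eco _ _ _ DR0 DT M0) i R1)// ?Pi//; congr (f _ _ _).
  by apply/funext => j; rewrite /two_agent_profile /upd; case: eqP.
(* Own-peak-onliness fixes only the share of agent [k] herself; feasibility passes this on to agent
   [i]. *)
- have : f (two_agent_profile i k R0 T M) (M * n%:R) k =
         f (two_agent_profile i k R0 T1 M) (M * n%:R) k.
    rewrite (op _ _ (eco _ _ _ DR0 DT M0) k T1)// ?Pk//; congr (f _ _ _).
    apply/funext => j; rewrite /two_agent_profile /upd.
    by case: eqP => // ->; rewrite (negbTE ki).
  by rewrite !fk// => /addrI/oppr_inj.
Qed.

(** * Maximality: gaps in the peak and rises away from it *)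

Section maximality.
Context (R : realType) (D : set (pref R)) (g : pref R -> pref R -> R -> R).
Hypotheses (SPLD : @SPL_dom R `<=` D) (DU : D `<=` @U_dom R).
Hypothesis gP : two_agent_rule D g.

(* With a second agent peaking at [2 M - c], the outcome for the first agent avoids
   [c]; whichever side of [c] it falls on, a suitably steep preference of the second
   agent, with the same peak and hence the same outcome, refutes it: on the left by
   the lower bound, on the right by efficiency. *)
Lemma no_gap (R0 : pref R) (a c M : R) : D R0 -> 0 <= a -> a < c -> c < M ->
  peak R0 a%:E -> ~ strict R0 M%:E c%:E.
Proof.
move=> DR0 a0 ac cM pa [Mc ncM].
have M0 : 0 < M by lra.
pose q := 2 * M - c.
have q0 : 0 <= q by rewrite /q; lra.
have Dq : D (sp_at q) by apply: SPLD; exact: sp_at_SPL.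
pose v := g R0 (sp_at q) M.
have /andP[v0 v2] : 0 <= v <= 2 * M by exact: (tar_bounds gP).
have vM : R0 v%:E M%:E by exact: (tar_lower1 gP).
have [vc|cv|vc] := ltgtP v c; last by apply: ncM; rewrite -vc.
(* The second agent gets more than [q], while [M] lies below [q] and is better for [T]. *)
- have [|||T [/SPLD DT pT [_ Tst]]] := @steep_right R M q (2 * M - v); rewrite /q; try lra.
  by apply: Tst; have := tar_lower2 gP DR0 DT M0; rewrite -(tar_peak2 gP DR0 Dq DT M0 pT).
(* Handing the first agent her peak point [a] moves the second from below [q] to above it, which [T]
   prefers. *)
- have [|||T [/SPLD DT pT Tst]] := @steep_left R (2 * M - v) q (2 * M - a); rewrite /q; try lra.
  have := @tar_efficient _ _ _ gP R0 T M a DR0 DT M0.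
  rewrite -(tar_peak2 gP DR0 Dq DT M0 pT); apply => //; first by lra.
  by apply: pa.2; rewrite /Xdom/= lee_fin.
Qed.

Section interval_peak.
Variables (R0 : pref R) (DR0 : D R0).
Hypothesis peakE : peak R0 = [set x | (plo R0 <= x)%E /\ (x <= phi R0)%E].

Let lo0 : (0 <= plo R0)%E := plo_ge0 R0.

Let lohi : (plo R0 <= phi R0)%E := plo_le_phi (DU DR0).

(** By own-peak-onliness [R0] and [S] lead to the same outcome, and the lower bound for [S] confines
    it. *)
Let S := tent 1 1 (plo R0) (phi R0).

Let S_SPL : SPL_dom S. Proof. exact: tent_SPL. Qed.

Let peakS : peak S = peak R0. Proof. by rewrite peak_tent// peakE. Qed.

(** With equal share [x], both [S] and a second agent peaking above [x] must receive at least [x],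
    hence exactly [x]. If [x'] were as good as [x] for [R0], moving to [x'] would hand the second
    agent her peak [2 * x - x'], against efficiency. *)
Lemma no_rise_left (x x' : R) : 0 <= x' -> x' < x -> (x%:E <= plo R0)%E ->
  ~ R0 x'%:E x%:E.
Proof.
move=> x'0 x'x xl h.
have x0 : 0 < x by lra.
have DS := SPLD S_SPL.
pose q := 2 * x - x'.
have q0 : 0 <= q by rewrite /q; lra.
have xq : x < q by rewrite /q; lra.
have Tq := sp_at_SPL q0; have DT := SPLD Tq.
have plT : plo (sp_at q) = q%:E by rewrite plo_tent// lee_fin.
pose v := g R0 (sp_at q) x.
have vS : v = g S (sp_at q) x by exact: (tar_peak1 gP).
have /andP[v0 v2] : 0 <= v <= 2 * x by exact: (tar_bounds gP).
have xv : x <= v.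
  apply: (SPL_pref_below S_SPL) => //; first exact: ltW.
    by rewrite plo_tent.
  by rewrite vS; exact: (tar_lower1 gP).
have vx : x <= 2 * x - v.
  apply: (SPL_pref_below Tq); [exact: ltW|by rewrite subr_ge0|by rewrite plT lee_fin ltW|].
  exact: (tar_lower2 gP).
have vE : v = x by lra.
apply: (@tar_efficient _ _ _ gP R0 (sp_at q) x x') => //; first by lra.
  by rewrite -/v vE.
rewrite -/v vE -/q (_ : 2 * x - x = x); last by lra.
by apply: Tq.2.2 => //; [exact: ltW|left; rewrite plT].
Qed.

(** The mirror image of [no_rise_left]; here the peak [2 * x - x'] of the second agent is
    nonnegative only when [x' <= 2 * x]. *)
Lemma no_rise_right_near (x x' : R) : 0 <= x -> x < x' -> x' <= 2 * x ->
  (phi R0 <= x%:E)%E -> ~ R0 x'%:E x%:E.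
Proof.
move=> x0' xx' x'2 xl h.
have x0 : 0 < x by lra.
have DS := SPLD S_SPL.
pose q := 2 * x - x'.
have q0 : 0 <= q by rewrite /q; lra.
have qx : q < x by rewrite /q; lra.
have Tq := sp_at_SPL q0; have DT := SPLD Tq.
have phT : phi (sp_at q) = q%:E by rewrite phi_tent// lee_fin.
pose v := g R0 (sp_at q) x.
have vS : v = g S (sp_at q) x by exact: (tar_peak1 gP).
have /andP[v0 v2] : 0 <= v <= 2 * x by exact: (tar_bounds gP).
have vx : v <= x.
  apply: (SPL_pref_above S_SPL) => //; first by rewrite phi_tent.
  by rewrite vS; exact: (tar_lower1 gP).
have xv : 2 * x - v <= x.
  apply: (SPL_pref_above Tq); [by []|by rewrite subr_ge0|by rewrite phT lee_fin ltW|].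
  exact: (tar_lower2 gP).
have vE : v = x by lra.
apply: (@tar_efficient _ _ _ gP R0 (sp_at q) x x') => //; first by lra.
  by rewrite -/v vE.
rewrite -/v vE -/q (_ : 2 * x - x = x); last by lra.
by apply: Tq.2.2 => //; right; rewrite phT.
Qed.

End interval_peak.

(* A rise to the right of the peak can be located between two points [y < y'] with
   [y' <= 2 * y], where the second agent can afford it. *)
Lemma no_rise_right (R0 : pref R) (x x' : R) : D R0 ->
  peak R0 = [set x | (plo R0 <= x)%E /\ (x <= phi R0)%E] ->
  0 <= x -> x < x' -> (phi R0 <= x%:E)%E -> ~ R0 x'%:E x%:E.
Proof.
move=> DR0 peakE x0 xx' xl.
have [sub [tot [tr _]]] := DU DR0.
have near y y' : x <= y -> y < y' -> y' <= 2 * y -> strict R0 y%:E y'%:E.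
  move=> xy yy' y'2; have y0 := le_trans x0 xy; have y'0 := le_trans y0 (ltW yy').
  apply: not_pref_strict; rewrite /Xdom/= ?lee_fin//; first exact: DU.
  apply: (no_rise_right_near DR0 peakE y0 yy' y'2).
  by apply: le_trans xl _; rewrite lee_fin.
(* Multiples of 0 reach nothing, so this case is separate: the peak is then reduced to 0, yet [x']
   would belong to it. *)
have := x0; rewrite le_eqVlt => /predU1P[xE|x_gt0].
  have px : peak R0 x%:E.
    have [p pp] := peak_nonempty (DU DR0).
    have : (p <= x%:E)%E by apply: le_trans xl; exact: ereal_sup_ubound.
    rewrite -xE => p0; suff -> : 0%:E = p by [].
    by apply/eqP; rewrite eq_le p0 pp.1.
  move=> h; have : peak R0 x'%:E.
    by split => [|y /px.2]; [exact: (sub _ _ h).1|exact: tr].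
  rewrite peakE => -[_ h']; have := le_trans h' xl; rewrite lee_fin; lra.
(* Stepping down by [x] from [y > 2 * x] stays within the factor 2 and reaches a strictly better
   point, so the bound on [y] drops by one multiple of [x]. *)
have chain m y : x < y -> y <= x *+ m.+2 -> ~ R0 y%:E x%:E.
  elim: m y => [|m IH] y xy; first by rewrite -mulr_natl => h; have [] := near x y.
  rewrite mulrS => ym.
  have [y2|y2] := leP y (2 * x); first by have [] := near x y.
  have [|||a1 a2] := near (y - x) y; [lra|lra|lra|].
  by move=> h; apply: (IH (y - x)); [lra|lra|exact: tr a1 h].
apply: (chain (Num.bound (x' / x))) => //.
rewrite -mulr_natl -ler_pdivrMr//; apply: le_trans (ltW (archi_boundP _)) _.
  by rewrite divr_ge0// ltW// (lt_trans x_gt0).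
by rewrite ler_nat leqW.
Qed.

(** Both ends of the peak belong to it by closedness. A missing point [c] between them contradicts
    [no_gap] once a real [M] beyond [c] and strictly better than [c] is found. *)
Lemma two_agent_rule_interval (R0 : pref R) : D R0 ->
  peak R0 = [set x | (plo R0 <= x)%E /\ (x <= phi R0)%E].
Proof.
move=> DR0; have U0 := DU DR0; have [sub [tot [tr cl]]] := U0.
have p0 := peak_nonempty U0; have cp := peak_closed U0.
have plo_peak : peak R0 (plo R0) by exact: ereal_inf_closed.
have phi_peak : peak R0 (phi R0) by exact: ereal_sup_closed.
apply/seteqP; split => [x px|c [ac cb]].
  by split; [exact: ereal_inf_lbound|exact: ereal_sup_ubound].
apply: contrapT => npc.
have {}ac : (plo R0 < c)%E.
  by rewrite lt_neqAle ac andbT; apply/eqP => e; apply: npc; rewrite -e.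
have {}cb : (c < phi R0)%E.
  by rewrite lt_neqAle cb andbT; apply/eqP => e; apply: npc; rewrite e.
have a0 := plo_ge0 R0.
have c0 : Xdom c by exact: le_trans (ltW ac).
have b0 : Xdom (phi R0) by exact: phi_peak.1.
have ncb : ~ R0 c (phi R0).
  by move=> h; apply: npc; split => // y /phi_peak.2; exact: tr.
case: c => [c||] in npc ac cb c0 ncb *; [|by rewrite ltNge leey in cb|by []].
case plE: (plo R0) => [a||] in ac a0 plo_peak *; [|by []|by []].
have [M cM McP] : exists2 M : R, c < M & ~ R0 c%:E M%:E.
  case: (phi R0) => [b||] in cb ncb b0 *; [by exists b|..]; last by [].
  (* If the peak reaches infinity, [M] is found among large reals: the points weakly worse than [c]
     form a closed set that misses infinity. *)
  have oC : open (~` [set x | Xdom x /\ R0 c%:E x]).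
    by apply: closed_openC; exact: (cl _ c0).2.
  have : nbhs +oo%E (~` [set x | Xdom x /\ R0 c%:E x]).
    by apply: open_nbhs_nbhs; split => // -[_].
  move=> [K [_ hK]]; exists (Num.max K c + 1).
    by rewrite ltr_pwDr// le_max lexx orbT.
  move=> h; apply: (hK (Num.max K c + 1)%:E).
    by rewrite lte_fin ltr_pwDr// le_max lexx.
  by split => //; exact: (sub _ _ h).2.
apply: (@no_gap R0 a c M) => //.
apply: not_pref_strict => //; rewrite /Xdom/= lee_fin; apply: ltW.
by apply: le_lt_trans cM; rewrite -lee_fin.
Qed.

Lemma two_agent_rule_SPL : D `<=` @SPL_dom R.
Proof.
move=> R0 DR0; have pE := two_agent_rule_interval DR0; have U0 := DU DR0.
split => //; split => // x x' x0 x'0 h.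
apply: not_pref_strict; rewrite /Xdom/= ?lee_fin//.
by case: h => -[h1 h2]; [exact: no_rise_left|exact: no_rise_right].
Qed.

End maximality.

(** * Single-peaked preferences and the conclusion *)

Lemma SP_sub_SPL (R : realType) : @SP_dom R `<=` @SPL_dom R.
Proof.
move=> Ri [U0 [p [pE mono]]]; split => //.
have plE : plo Ri = p by rewrite /plo pE ereal_inf1.
have phE : phi Ri = p by rewrite /phi pE ereal_sup1.
rewrite plE phE; split => //; rewrite pE.
apply/seteqP; split => [x ->//|x [h1 h2]].
by apply/eqP; rewrite eq_le h1 h2.
Qed.

Theorem theorem3 (R : realType) (n : nat) (hn : (2 <= n)%N) :
  (@SP_dom R `<=` @SPL_dom R) /\
  (exists f : rule R n, good_rule (@SPL_dom R) f) /\
  (forall Dbar : set (pref R), @SPL_dom R `<` Dbar -> Dbar `<=` @U_dom R ->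
     ~ exists f : rule R n, good_rule Dbar f).
Proof.
have n0 : (0 < n)%N by apply: ltnW.
split; first exact: SP_sub_SPL.
split; first by exists (@fair_rule R n); exact: fair_rule_good.
move=> D [SPLD nD] DU [f good].
(* Since [hn] reads [1 < n], the two agents are those of index 1 and 0. *)
have ki : Ordinal hn != Ordinal n0 by [].
apply: nD; exact: (two_agent_rule_SPL SPLD DU (good_rule_two_agents SPLD DU good ki)).
Qed.
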